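(* There is an absolute constant $C>0$ such that for every $n\ge 2$ and every Boolean function $f:\{0,1\}^n\times\{0,1\}^n\to\{0,1\}$, $$Q^{\parallel}(f)\le C\cdot 2^{R^{\parallel,pub}(f)}\log n .$$
   Context: All protocols compute $f$ with error probability at most $1/3$ on every input. $Q^{\parallel}(f)$ is the minimal total number of qubits communicated in a quantum simultaneous-message-passing (SMP) protocol for $f$ with no shared randomness and no shared entanglement: Alice (holding $x$) and Bob (holding $y$) each send one quantum message to a referee who holds no input and outputs the answer. $R^{\parallel,pub}(f)$ is the minimal total number of bits communicated in a classical SMP protocol for $f$ in which Alice and Bob share an unlimited amount of public randomness (not counted in the cost); the referee does not see the shared randomness except through the messages. *)

(* Defs.v *)
(* with Stdlib's concrete reals R (a realType via Rstruct)
   and complex numbers R[i] from mathcomp-real-closed. *)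
From HB Require Import structures.
From mathcomp Require Import all_boot all_order all_algebra.
From mathcomp Require Import complex mxtens.
From mathcomp Require Import Rstruct.
From Stdlib Require Rdefinitions Rpower.
Set Implicit Arguments.
Unset Strict Implicit.
Unset Printing Implicit Defensive.
Import Order.TTheory GRing.Theory Num.Theory.
Local Open Scope ring_scope.

(** n-bit strings {0,1}^n *)
Definition bits (n : nat) := {ffun 'I_n -> bool}.

(** complex numbers *)
Definition Cplx : Type := (Rdefinitions.R)[i].

(** conjugate transpose *)
Definition adjmx (m k : nat) (A : 'M[Cplx]_(m, k)) : 'M[Cplx]_(k, m) :=
  (map_mx (fun z : Cplx => z^*) A)^T.

(** positive semidefinite (Hermitian, nonnegative quadratic form) *)
Definition psd (k : nat) (A : 'M[Cplx]_k) : Prop :=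
  adjmx A = A /\ forall v : 'cV[Cplx]_k, 0 <= (adjmx v *m A *m v) 0 0.

(** density matrix (mixed quantum state) on k-dimensional space *)
Definition density (k : nat) (rho : 'M[Cplx]_k) : Prop :=
  psd rho /\ \tr rho = 1.

(** A quantum SMP protocol for f, with no shared randomness and no shared
    entanglement, in which Alice sends a qubits and Bob sends b qubits with
    a + b = q.  Alice's message on input x is an arbitrary (mixed) state
    rho x on (C^2)^{(x) a} = C^(2^a) (private randomness/ancillas allowed),
    Bob's is sigma y on C^(2^b); the referee performs a two-outcome POVM
    {M, 1 - M} on the joint state rho x (x) sigma y and outputs 1 on outcome M.
    Error probability at most 1/3 on every input. *)
Definition quantSMP (n : nat) (f : bits n -> bits n -> bool) (q : nat) : Prop :=
  exists (a b : nat)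
         (rho : bits n -> 'M[Cplx]_(2 ^ a))
         (sigma : bits n -> 'M[Cplx]_(2 ^ b))
         (M : 'M[Cplx]_(2 ^ a * 2 ^ b)),
    (a + b)%N = q /\
    (forall x, density (rho x)) /\
    (forall y, density (sigma y)) /\
    psd M /\ psd (1%:M - M) /\
    (forall x y,
        let p1 := \tr (M *m (rho x *t sigma y)) in
        if f x y then 2%:R / 3%:R <= p1 else p1 <= 1 / 3%:R).

(** A classical SMP protocol for f with public randomness, where Alice sends
    a bits and Bob sends b bits with a + b = c.  The public randomness is a
    probability distribution p on a finite sample space Omega (private coins
    of Alice and Bob are absorbed into it); Alice's message is A w x, Bob's is
    B w y; the referee sees only the two messages and outputs 1 with
    probability ref ma mb (it may use private coins).  Error probability at
    most 1/3 on every input. *)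
Definition pubSMP (n : nat) (f : bits n -> bits n -> bool) (c : nat) : Prop :=
  exists (a b : nat) (Omega : finType) (p : Omega -> Rdefinitions.R)
         (A : Omega -> bits n -> bits a) (B : Omega -> bits n -> bits b)
         (ref : bits a -> bits b -> Rdefinitions.R),
    (a + b)%N = c /\
    (forall w, 0 <= p w) /\ \sum_(w : Omega) p w = 1 /\
    (forall ma mb, 0 <= ref ma mb <= 1) /\
    (forall x y,
        let p1 := \sum_(w : Omega) p w * ref (A w x) (B w y) in
        if f x y then 2%:R / 3%:R <= p1 else p1 <= 1 / 3%:R).

(* Main.v *)
Require Import Defs.
From HB Require Import structures.
From mathcomp Require Import all_boot all_order all_algebra.
From mathcomp Require Import complex mxtens.
From mathcomp Require Import Rstruct.
From mathcomp Require Import ring lra zify.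
From Stdlib Require Rdefinitions Rpower.
Set Implicit Arguments.
Unset Strict Implicit.
Unset Printing Implicit Defensive.
Import Order.TTheory GRing.Theory Num.Theory.
Local Open Scope ring_scope.

Local Notation R := Rdefinitions.R.

(** By a sampling argument (Newman) the public randomness can be taken uniform
    on O(n) points, at the price of a slightly larger error.  With [k] sample
    points, the acceptance probability of the sampled protocol is then
    [sqrt (2 ^ a)] times the inner product of the unit vectors with entries
    [(A i x == m) / sqrt k] and [ref m (B i y) / sqrt (k * 2 ^ a)], where [m]
    ranges over the [2 ^ a] messages of Alice (the second vector being
    completed to norm 1).  A common constant component makes the squared inner
    product linear to first order in this quantity, so the swap test detects a
    gap of order [2 ^ (- a / 2)], and by Chebyshev O(2 ^ a) copies suffice.  Exchanging the
    roles of Alice and Bob if necessary, [2 * a <= c]; the cost is therefore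
    O(2 ^ a * (log n + a)) = O(2 ^ c * log n). *)

(** * Tensor powers of measurements *)

Lemma conj_real_complex (r : R) : Num.conj (r%:C%C : Cplx) = r%:C%C.
Proof. by apply: conj_Creal; apply/complex_realP; exists r. Qed.

Lemma adjmxK m k (A : 'M[Cplx]_(m, k)) : adjmx (adjmx A) = A.
Proof. by apply/matrixP => i j; rewrite !mxE conjCK. Qed.

Lemma adjmxM m k l (A : 'M[Cplx]_(m, k)) (B : 'M[Cplx]_(k, l)) :
  adjmx (A *m B) = adjmx B *m adjmx A.
Proof.
apply/matrixP => i j; rewrite !mxE rmorph_sum; apply: eq_bigr => h _.
by rewrite !mxE rmorphM mulrC.
Qed.

Lemma psd_gram m k (B : 'M[Cplx]_(m, k)) : psd (B *m adjmx B).
Proof.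
split=> [|v]; first by rewrite adjmxM adjmxK.
have -> : adjmx v *m (B *m adjmx B) *m v
    = adjmx (adjmx B *m v) *m (adjmx B *m v).
  by rewrite adjmxM adjmxK !mulmxA.
rewrite mxE.
rewrite sumr_ge0 // => i _; rewrite !mxE /= mulrC; exact: mul_conjC_ge0.
Qed.

Lemma psd_sum (J : finType) (P : pred J) m (F : J -> 'M[Cplx]_m) :
  (forall j, P j -> psd (F j)) -> psd (\sum_(j | P j) F j).
Proof.
move=> psdF; split=> [|v].
  apply/matrixP => i h; rewrite !mxE !summxE rmorph_sum.
  by apply: eq_bigr => j /psdF-[adjF _]; rewrite -{2}adjF !mxE.
rewrite mulmx_sumr mulmx_suml summxE; apply: sumr_ge0 => j Pj.
by have [_] := psdF j Pj; apply.
Qed.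

Lemma psd_herm_idem m (P : 'M[Cplx]_m) : adjmx P = P -> P *m P = P -> psd P.
Proof. by move=> adjP PP; rewrite -PP -{2}adjP; apply: psd_gram. Qed.

Lemma density_pure m (v : 'I_m -> R) :
  \sum_i v i ^+ 2 = 1 ->
  density (\matrix_(i, j) (v i * v j)%:C%C : 'M[Cplx]_m).
Proof.
move=> v1; pose w : 'cV[Cplx]_m := \col_i (v i)%:C%C.
split; last first.
  rewrite /mxtrace -[RHS](rmorph1 (real_complex R)) -v1 rmorph_sum.
  by apply: eq_bigr => i _; rewrite mxE -expr2.
suff -> : (\matrix_(i, j) (v i * v j)%:C%C)%R = w *m adjmx w :> 'M[Cplx]_m.
  exact: psd_gram.
apply/matrixP => i j; rewrite !mxE big_ord1 !mxE conj_real_complex.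
by rewrite -rmorphM.
Qed.

Section TensorPower.
Variables (N : nat) (I U : finType) (E : 'I_N -> {ffun I -> U}).
Hypothesis E_bij : bijective E.

Lemma sum_tensor (V : comRingType) (F : I -> U -> V) :
  \sum_z \prod_i F i (E z i) = \prod_i \sum_u F i u.
Proof. by rewrite bigA_distr_bigA (reindex E) //; apply: onW_bij. Qed.

(** The tensor product over [I] of the real operators [Q i] on the space with basis [U]. [E] reads a
    basis index as the family of its local basis elements, which replaces iterated Kronecker
    products. *)
Definition tensor_op (Q : I -> U -> U -> R) : 'M[Cplx]_N :=
  \matrix_(z, z') (\prod_i Q i (E z i) (E z' i))%:C%C.

Lemma adjmx_tensor_op (Q : I -> U -> U -> R) : (forall i u v, Q i u v = Q i v u) ->
  adjmx (tensor_op Q) = tensor_op Q.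
Proof.
move=> symQ; apply/matrixP => z z'; rewrite !mxE conj_real_complex.
by under eq_bigr do rewrite symQ.
Qed.

Lemma tensor_op_idem (Q : I -> U -> U -> R) :
    (forall i u v, \sum_w Q i u w * Q i w v = Q i u v) ->
  tensor_op Q *m tensor_op Q = tensor_op Q.
Proof.
move=> QQ; apply/matrixP => z z'; rewrite !mxE.
under [LHS] eq_bigr do rewrite !mxE -rmorphM -big_split /=.
rewrite -rmorph_sum (sum_tensor (fun i w => Q i (E z i) w * Q i w (E z' i))).
by under eq_bigr do rewrite QQ.
Qed.

Lemma sum_tensor_op (S : finType) (Q : S -> U -> U -> R) :
    (forall u v, \sum_s Q s u v = (u == v)%:R) ->
  \sum_(s : {ffun I -> S}) tensor_op (fun i => Q (s i)) = 1%:M.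
Proof.
move=> sumQ; apply/matrixP => z z'; rewrite summxE !mxE.
under [LHS]eq_bigr do rewrite !mxE.
rewrite -rmorph_sum -(bigA_distr_bigA (fun i s => Q s (E z i) (E z' i))) /=.
under eq_bigr do rewrite sumQ.
rewrite -(rmorph_nat (real_complex R)) /=; congr (_%:C%C).
have [->|zz'] := eqVneq z z'; first by rewrite big1 // => i _; rewrite eqxx.
suff [i /negPf neq_i] : exists i, E z i != E z' i.
  by rewrite (bigD1 i) //= neq_i mul0r.
apply/existsP; apply: contraNT zz'; rewrite negb_exists => /forallP eqE.
by apply/eqP/(bij_inj E_bij)/ffunP => i; apply/eqP; rewrite -[_ == _]negbK.
Qed.

(** The hypothesis says that [rho] is the pure product state with amplitude [psi] in every factor,
    so outcomes of the different factors are independent. *)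
Lemma trace_tensor_op Q (psi : U -> R) (rho : 'M[Cplx]_N) :
    (forall z z', rho z z' =
      ((\prod_i psi (E z i)) * \prod_i psi (E z' i))%:C%C) ->
  \tr (tensor_op Q *m rho) =
  (\prod_i \sum_u \sum_v Q i u v * (psi u * psi v))%:C%C.
Proof.
move=> rhoE; rewrite /mxtrace.
under [LHS]eq_bigr => z _.
  rewrite mxE.
  under eq_bigr => z' _ do rewrite mxE rhoE -!rmorphM [X in _ * X]mulrC
    -!big_split /=.
  rewrite -rmorph_sum (sum_tensor
    (fun i v => Q i (E z i) v * (psi (E z i) * psi v))) /=.
  over.
by rewrite -rmorph_sum (sum_tensor
    (fun i u => \sum_v Q i u v * (psi u * psi v))).
Qed.

End TensorPower.

(** * The repeated swap test *)

Section IndependentSum.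
Variables (I S : finType) (w h : S -> R).
Hypotheses (w_ge0 : forall s, 0 <= w s) (w_sum1 : \sum_s w s = 1).
Hypothesis h_mean0 : \sum_s w s * h s = 0.

Lemma variance_independent_sum :
  \sum_(s : {ffun I -> S}) (\prod_i w (s i)) * (\sum_i h (s i)) ^+ 2 =
  #|I|%:R * \sum_s w s * h s ^+ 2.
Proof.
have cov i j : \sum_(s : {ffun I -> S}) (\prod_k w (s k)) * (h (s i) * h (s j))
    = if i == j then \sum_s w s * h s ^+ 2 else 0.
  (* Insert the two factors [h] at coordinates [i] and [j], so that the moment becomes a product of
     one-coordinate sums. For distinct [i] and [j] the factor at [i] is the mean, which is 0. *)
  pose F k s := w s * ((if k == i then h s else 1) * (if k == j then h s else 1)).
  transitivity (\prod_k \sum_s F k s).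
    rewrite bigA_distr_bigA; apply: eq_bigr => s _.
    rewrite [RHS]big_split /=; congr (_ * _); rewrite big_split /=.
    by rewrite -!big_mkcond /= !big_pred1_eq.
  have [eij|ij] := eqVneq i j.
    subst j; rewrite (bigD1 i) //= [X in _ * X]big1 ?mulr1 => [|k /negPf ki].
      by apply: eq_bigr => s _; rewrite /F eqxx expr2.
    by rewrite -[RHS]w_sum1; apply: eq_bigr => s _; rewrite /F ki !mulr1.
  rewrite (bigD1 i) //= [X in X * _](_ : _ = 0) ?mul0r // -[RHS]h_mean0.
  by apply: eq_bigr => s _; rewrite /F eqxx (negPf ij) mulr1.
transitivity (\sum_(i : I) \sum_(j : I) \sum_(s : {ffun I -> S})
    (\prod_k w (s k)) * (h (s i) * h (s j))).
  under [RHS]eq_bigr do rewrite exchange_big; rewrite [RHS]exchange_big /=.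
  apply: eq_bigr => s _; rewrite expr2 big_distrlr mulr_sumr /=.
  by apply: eq_bigr => i _; rewrite mulr_sumr.
under eq_bigr => i _ do
  (under eq_bigr do rewrite cov eq_sym; rewrite -big_mkcond big_pred1_eq).
by rewrite big_const iter_addr_0 mulr_natl.
Qed.

Lemma chebyshev_independent_sum (P : pred {ffun I -> S}) (eps : R) :
    (forall s, P s -> eps <= (\sum_i h (s i)) ^+ 2) ->
  eps * (\sum_(s | P s) \prod_i w (s i)) <= #|I|%:R * \sum_s w s * h s ^+ 2.
Proof.
move=> Peps; rewrite -variance_independent_sum mulr_sumr.
have W_ge0 (s : {ffun I -> S}) : 0 <= \prod_i w (s i) by apply: prodr_ge0.
rewrite [leRHS](bigID P) /= -[leLHS]addr0; apply: lerD.
  by apply: ler_sum => s Ps; rewrite mulrC ler_wpM2l // Peps.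
by apply: sumr_ge0 => s _; rewrite mulr_ge0 ?sqr_ge0.
Qed.

End IndependentSum.

Section SwapTest.
Variable T : finType.

(** Matrix entries of the projections (1 + SWAP)/2 for [true] and (1 - SWAP)/2 for [false], onto the
    symmetric and antisymmetric subspaces. *)
Definition swap_test (b : bool) (u v : T * T) : R :=
  ((u == v)%:R + (-1) ^+ (~~ b) * (u == (v.2, v.1))%:R) / 2%:R.

Lemma swap_eq (u v : T * T) : (u == (v.2, v.1)) = ((u.2, u.1) == v).
Proof. by case: u v => [a b] [c d] /=; rewrite !xpair_eqE andbC. Qed.

Lemma sum_eq_mul (U : finType) (u : U) (F : U -> R) :
  \sum_v (u == v)%:R * F v = F u.
Proof.
under eq_bigr do rewrite mulr_natl mulrb eq_sym.
by rewrite -big_mkcond big_pred1_eq.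
Qed.

Lemma swap_test_sym b u v : swap_test b u v = swap_test b v u.
Proof. by rewrite /swap_test swap_eq [v == u]eq_sym [v == _]eq_sym. Qed.

Lemma sum_swap_test_mul b u (F : T * T -> R) :
  \sum_v swap_test b u v * F v =
  (F u + (-1) ^+ (~~ b) * F (u.2, u.1)) / 2%:R.
Proof.
rewrite -(sum_eq_mul u F) -(sum_eq_mul (u.2, u.1) F) mulr_sumr -big_split /=.
rewrite mulr_suml; apply: eq_bigr => v _; rewrite /swap_test swap_eq; ring.
Qed.

Lemma swap_test_idem b u v :
  \sum_w swap_test b u w * swap_test b w v = swap_test b u v.
Proof.
rewrite sum_swap_test_mul /swap_test swap_eq /= -swap_eq.
rewrite (_ : ((u.2, u.1) == (v.2, v.1)) = (u == v)); last first.
  by case: u v => [a c] [e g]; rewrite !xpair_eqE andbC.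
by case: b => /=; field.
Qed.

Lemma sum_swap_test u v : \sum_b swap_test b u v = (u == v)%:R.
Proof. by rewrite big_bool /swap_test /=; field. Qed.

Lemma swap_test_mean b (alpha beta : T -> R) :
    \sum_u alpha u ^+ 2 = 1 -> \sum_u beta u ^+ 2 = 1 ->
  \sum_u \sum_v swap_test b u v *
    ((alpha u.1 * beta u.2) * (alpha v.1 * beta v.2)) =
  (1 + (-1) ^+ (~~ b) * (\sum_u alpha u * beta u) ^+ 2) / 2%:R.
Proof.
move=> alpha1 beta1; under eq_bigr do rewrite sum_swap_test_mul /=.
rewrite -mulr_suml big_split -mulr_sumr /=; congr ((_ + _ * _) / _).
  rewrite -[1]mulr1 -{1}alpha1 -beta1 big_distrlr /= pair_big /=.
  by apply: eq_bigr => -[u v] _ /=; ring.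
rewrite expr2 big_distrlr /= pair_big /=.
by apply: eq_bigr => -[u v] _ /=; ring.
Qed.

End SwapTest.

(** * Swap tests on many copies *)

Lemma ord_ffun_bij (T : finType) d t : #|T| = (2 ^ d)%N ->
  exists e : 'I_(2 ^ (d * t)) -> {ffun 'I_t -> T}, bijective e.
Proof.
move=> cardT; have card_eq : (2 ^ (d * t))%N = #|{ffun 'I_t -> T}|.
  by rewrite card_ffun card_ord cardT expnM.
exists (enum_val \o cast_ord card_eq); apply: bij_comp (@enum_val_bij _) _.
by exists (cast_ord (esym card_eq)); [apply: cast_ordK|apply: cast_ordKV].
Qed.

(** Regroups Alice's [t] copies and Bob's [t] copies into [t] pairs, so that the i-th swap test acts
    on the i-th copy of each. *)
Definition pair_index (T : finType) t N (e : 'I_N -> {ffun 'I_t -> T})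
    (z : 'I_(N * N)) : {ffun 'I_t -> T * T} :=
  [ffun i => (e (mxtens_unindex z).1 i, e (mxtens_unindex z).2 i)].

Lemma pair_index_bij (T : finType) t N (e : 'I_N -> {ffun 'I_t -> T}) :
  bijective e -> bijective (pair_index e).
Proof.
case=> e' eK e'K.
exists (fun s : {ffun 'I_t -> T * T} => mxtens_index
  (e' [ffun i => (s i).1], e' [ffun i => (s i).2])) => [z|s].
  rewrite /pair_index -[RHS]mxtens_unindexK; case: (mxtens_unindex z) => i j /=.
  by congr (mxtens_index (_, _)); rewrite -[RHS]eK; congr e'; apply/ffunP => h;
    rewrite !ffunE.
apply/ffunP => i; rewrite !ffunE mxtens_indexK /= !e'K !ffunE.
by case: (s i).
Qed.

Section SwapTestProtocol.
Variables (n d t : nat) (T : finType) (f : bits n -> bits n -> bool).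
Variables (alpha beta : bits n -> T -> R) (theta gamma : R).
Hypothesis card_T : #|T| = (2 ^ d)%N.
Hypothesis alpha1 : forall x, \sum_u alpha x u ^+ 2 = 1.
Hypothesis beta1 : forall y, \sum_u beta y u ^+ 2 = 1.
Hypotheses (gamma_gt0 : 0 < gamma) (t_large : 3 <= t%:R * gamma ^+ 2).
Hypothesis separated : forall x y,
  let r := \sum_u alpha x u * beta y u in
  if f x y then theta + gamma <= r ^+ 2 else r ^+ 2 <= theta - gamma.

Let q x y b : R :=
  (1 + (-1) ^+ (~~ b) * (\sum_u alpha x u * beta y u) ^+ 2) / 2.

(** The threshold is the expected number of symmetric outcomes when the squared overlap equals
    [theta]. *)
Let accept (s : {ffun 'I_t -> bool}) :=
  t%:R * ((1 + theta) / 2) <= \sum_i (s i)%:R.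

(** Cauchy-Schwarz: with r the overlap itself, the squared norm of [alpha x] - r [beta y] is 1 -
    r^2. *)
Lemma overlap_sqr_le1 x y : (\sum_u alpha x u * beta y u) ^+ 2 <= 1.
Proof.
have expand (r : R) : \sum_u (alpha x u - r * beta y u) ^+ 2
    = 1 - 2 * r * (\sum_u alpha x u * beta y u) + r ^+ 2.
  transitivity (\sum_u alpha x u ^+ 2 - 2 * r * (\sum_u alpha x u * beta y u)
    + r ^+ 2 * \sum_u beta y u ^+ 2); last by rewrite alpha1 beta1 mulr1.
  rewrite !mulr_sumr -sumrN -!big_split.
  by apply: eq_bigr => u _ /=; ring.
move: (\sum_u alpha x u * beta y u) expand => r /(_ r) expand.
have : 0 <= \sum_u (alpha x u - r * beta y u) ^+ 2.
  by apply: sumr_ge0 => u _; apply: sqr_ge0.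
rewrite expand; lra.
Qed.

(** One test has variance at most 1/4, so Chebyshev bounds the probability by (t/4) / (t gamma/2)^2
    = 1 / (t gamma^2), which [t_large] makes at most 1/3. *)
Lemma swap_test_tail x y (P : pred {ffun 'I_t -> bool}) :
    (forall s, P s -> (t%:R * (gamma / 2)) ^+ 2 <=
      (\sum_i ((s i)%:R - q x y true)) ^+ 2) ->
  \sum_(s | P s) \prod_i q x y (s i) <= 1 / 3.
Proof.
move=> Pdev; have r2_ge0 := sqr_ge0 (\sum_u alpha x u * beta y u).
have r2_le1 := overlap_sqr_le1 x y.
have q_ge0 b : 0 <= q x y b by rewrite /q; case: b => /=; lra.
have q_sum1 : \sum_b q x y b = 1 by rewrite big_bool /q /=; field.
have mean0 : \sum_(b : bool) q x y b * (b%:R - q x y true) = 0.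
  by rewrite big_bool /q /=; field.
have := chebyshev_independent_sum q_ge0 q_sum1 mean0 Pdev.
rewrite card_ord => dev; have {dev} dev := le_trans dev _.
set pr := \sum_(s | P s) _ in dev *.
have var_le : \sum_(b : bool) q x y b * (b%:R - q x y true) ^+ 2 <= 1 / 4.
  rewrite big_bool /q /=; nra.
have pr_ge0 : 0 <= pr by apply: sumr_ge0 => s _; apply: prodr_ge0.
have t_ge0 : 0 <= t%:R :> R by [].
have t_gt0 : 0 < t%:R :> R.
  by rewrite lt_neqAle t_ge0 andbT; apply: contraTneq t_large => <-; lra.
have := dev (t%:R * (1 / 4)) (ler_wpM2l t_ge0 var_le).
rewrite (_ : _ * pr = t%:R * ((t%:R * gamma ^+ 2) * pr / 4)); last by field.
rewrite ler_pM2l // => le14.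
have := ler_wpM2r pr_ge0 t_large; lra.
Qed.

Lemma swap_test_decides x y :
  let p1 := \sum_(s | accept s) \prod_i q x y (s i) in
  if f x y then 2 / 3 <= p1 else p1 <= 1 / 3.
Proof.
have total : \sum_(s : {ffun 'I_t -> bool}) \prod_i q x y (s i) = 1.
  by rewrite -(bigA_distr_bigA (fun=> q x y)) big1 // => i _; rewrite big_bool /q /=; field.
have sum_dev s : \sum_(i < t) ((s i : bool)%:R - q x y true)
    = \sum_(i < t) (s i)%:R - t%:R * q x y true.
  by rewrite sumrB sumr_const card_ord mulr_natl.
have t_ge0 : 0 <= t%:R :> R by [].
have := separated x y; set r := \sum_u _ => /=.
have dev_ge0 : 0 <= t%:R * (gamma / 2) by rewrite mulr_ge0 // divr_ge0 // ltW.
have sqr_mono a : t%:R * (gamma / 2) <= a ->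
    (t%:R * (gamma / 2)) ^+ 2 <= a ^+ 2.
  by move=> le_a; rewrite ler_sqr ?nnegrE // (le_trans dev_ge0).
have qE : q x y true = (1 + r ^+ 2) / 2 by rewrite /q mul1r.
case: ifP => _ sep.
  rewrite (bigID accept) /= in total.
  suff : \sum_(s | ~~ accept s) \prod_i q x y (s i) <= 1 / 3 by lra.
  apply: swap_test_tail => s; rewrite -ltNge => rej.
  rewrite sum_dev qE -[leRHS]sqrrN; apply: sqr_mono => //.
  have := ler_wpM2l t_ge0 sep; lra.
apply: swap_test_tail => s acc; rewrite sum_dev qE; apply: sqr_mono => //.
rewrite /accept in acc; have := ler_wpM2l t_ge0 sep; lra.
Qed.

Lemma swap_test_protocol : quantSMP f (d * t + d * t).
Proof.
have [e e_bij] := ord_ffun_bij t card_T.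
have := pair_index_bij e_bij; set E := pair_index e => E_bij.
pose M (s : {ffun 'I_t -> bool}) : 'M[Cplx]_(2 ^ (d * t) * 2 ^ (d * t)) :=
  tensor_op E (fun i => swap_test (T := T) (s i)).
have M_psd s : psd (M s).
  apply: psd_herm_idem; last by apply: tensor_op_idem => // i u v;
    apply: swap_test_idem.
  by apply: adjmx_tensor_op => i u v; apply: swap_test_sym.
have M_sum : \sum_s M s = 1%:M.
  exact: (sum_tensor_op E_bij (@sum_swap_test T)).
pose state (phi : T -> R) : 'M[Cplx]_(2 ^ (d * t)) :=
  \matrix_(z, z') ((\prod_i phi (e z i)) * \prod_i phi (e z' i))%:C%C.
have state_density phi : \sum_u phi u ^+ 2 = 1 -> density (state phi).
  move=> phi1; apply: (density_pure (v := fun z => \prod_i phi (e z i))).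
  under eq_bigr do rewrite -prodrXl.
  rewrite (sum_tensor e_bij (fun _ u => phi u ^+ 2)).
  by rewrite big1.
exists (d * t)%N, (d * t)%N, (state \o alpha), (state \o beta).
(* The referee's operator adds up the projections of all accepted outcome strings; its complement is
   the sum over the rejected ones. *)
exists (\sum_(s | accept s) M s); split=> //.
split=> [x|]; first exact: state_density.
split=> [y|]; first exact: state_density.
split; first exact: psd_sum.
split.
  rewrite -M_sum (bigID accept) /= addrC addrK; exact: psd_sum.
move=> x y; cbv zeta; set p1 := \tr _.
have -> : p1 = (\sum_(s | accept s) \prod_i q x y (s i))%:C%C.
  rewrite /p1 mulmx_suml raddf_sum rmorph_sum; apply: eq_bigr => s _.
  rewrite /= /M (trace_tensor_op E_bij _ (psi := fun u => alpha x u.1 * beta y u.2)).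
    by under eq_bigr do rewrite swap_test_mean //.
  move=> z z'; rewrite !mxE -rmorphM; congr (_%:C%C).
  under [X in _ = X * _]eq_bigr do rewrite ffunE.
  under [X in _ = _ * X]eq_bigr do rewrite ffunE.
  by rewrite !big_split /=; ring.
have := swap_test_decides x y; case: ifP => _ /= h.
  by rewrite -!(rmorph_nat (real_complex R)) -fmorphV -rmorphM lecR.
by rewrite -!(rmorph_nat (real_complex R)) -(rmorph1 (real_complex R)) -fmorphV -rmorphM lecR.
Qed.

End SwapTestProtocol.

(** * Reduction of the public randomness *)

(** If every [F w] exceeded [b], the nonnegative terms [p w * (F w - b)] would have sum 0, forcing
    every [p w] to vanish. *)
Lemma exists_le_mean (Omega : finType) (p F : Omega -> R) (b : R) :
    (forall w, 0 <= p w) -> \sum_w p w = 1 -> \sum_w p w * F w <= b ->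
  exists w, F w <= b.
Proof.
move=> p_ge0 p1 leFb; apply/existsP; apply: contraT; rewrite negb_exists.
move=> /forallP noF; have ltbF w : b < F w by rewrite ltNge.
have term_ge0 w : 0 <= p w * (F w - b) by rewrite mulr_ge0 // subr_ge0 ltW.
have sumE : \sum_w p w * (F w - b) = \sum_w p w * F w - b.
  by under eq_bigr do rewrite mulrBr; rewrite sumrB -mulr_suml p1 mul1r.
have sum0 : \sum_w p w * (F w - b) = 0.
  by apply: le_anti; rewrite sumr_ge0 // sumE subr_le0 leFb.
have := oner_neq0 R; rewrite -p1 big1 ?eqxx // => w _.
have /psumr_eq0P/(_ sum0 w isT)/eqP := fun w (_ : true) => term_ge0 w.
by rewrite mulf_eq0 subr_eq0 [F w == b]gt_eqF // orbF => /eqP.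
Qed.

(** * Exponential inequalities and the choice of sample points *)

Local Notation exp := Rtrigo_def.exp.

Lemma Rexp_gt0 (x : R) : 0 < exp x.
Proof. by apply/RltP; apply: Exp_prop.exp_pos. Qed.

Lemma Rexp_ge1Dx (x : R) : 1 + x <= exp x.
Proof. by apply/RleP; apply: Rpower.exp_ineq1_le. Qed.

Lemma Rexp_le_inv (x y : R) : exp x <= exp y -> x <= y.
Proof.
by rewrite !leNgt; apply: contra => /RltP /Rpower.exp_increasing /RltP.
Qed.

Lemma RexpD (x y : R) : exp (x + y) = exp x * exp y.
Proof. exact: esym (expRD x y). Qed.

Lemma RexpMn (x : R) (n : nat) : exp (x *+ n) = exp x ^+ n.
Proof. exact: esym (expRX x n). Qed.

(** Since exp u >= 1 + u, the right side times exp u is at least (1 - u + u^2)(1 + u) = 1 + u^3 >=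
    1. *)
Lemma RexpN_le (u : R) : 0 <= u -> exp (- u) <= 1 - u + u ^+ 2.
Proof.
move=> u_ge0; have := Rexp_ge1Dx u; have expN : exp (- u) * exp u = 1.
  by rewrite -RexpD addNr expR0.
have e_gt0 := Rexp_gt0 (- u) => le_e.
have q_ge0 : 0 <= 1 - u + u ^+ 2 by have := sqr_ge0 (u - 1); nra.
have : 1 <= (1 - u + u ^+ 2) * exp u.
  apply: le_trans (ler_wpM2l q_ge0 le_e); have := exprn_ge0 3 u_ge0; nra.
move=> /(ler_wpM2l (ltW e_gt0)); rewrite mulr1 mulrCA expN mulr1; exact.
Qed.

Section Sampling.
Variables (Omega Z : finType) (p : Omega -> R) (g : Omega -> Z -> R).
Hypotheses (p_ge0 : forall w, 0 <= p w) (p_sum1 : \sum_w p w = 1).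
Hypothesis g_unit : forall w z, 0 <= g w z <= 1.
Hypothesis g_mean : forall z, 2 / 3 <= \sum_w p w * g w z.

(* Derandomised choice of the sample: each new point is chosen so that the
   potential shrinks by the factor it shrinks by on average. *)
Lemma exists_sample_potential (eta : R) (k : nat) : 0 <= eta ->
  exists W : k.-tuple Omega,
    \sum_z exp (- (eta * \sum_(i < k) g (tnth W i) z)) <=
    #|Z|%:R * exp (- (2 / 3 * eta - eta ^+ 2)) ^+ k.
Proof.
move=> eta_ge0; elim: k => [|k [W IHW]].
  exists [tuple]; under eq_bigr do rewrite big_ord0 mulr0 oppr0 expR0.
  by rewrite sumr_const expr0 mulr1.
pose V z := exp (- (eta * \sum_(i < k) g (tnth W i) z)).
pose F w := \sum_z V z * exp (- (eta * g w z)).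
have mean_le : \sum_w p w * F w <=
    #|Z|%:R * exp (- (2 / 3 * eta - eta ^+ 2)) ^+ k.+1.
  rewrite exprSr mulrA; apply: le_trans (ler_wpM2r (ltW (Rexp_gt0 _)) IHW).
  under eq_bigr do rewrite mulr_sumr.
  rewrite exchange_big mulr_suml /=; apply: ler_sum => z _.
  under eq_bigr do rewrite mulrCA.
  rewrite -mulr_sumr; apply: (ler_wpM2l (ltW (Rexp_gt0 _))).
  apply: le_trans (Rexp_ge1Dx _).
  apply: (@le_trans _ _ (\sum_w p w * (1 - eta * g w z + eta ^+ 2))).
    apply: ler_sum => w _; apply: ler_wpM2l => //.
    have /andP[g0 g1] := g_unit w z.
    apply: le_trans (RexpN_le (mulr_ge0 eta_ge0 g0)) _.
    rewrite lerD2l exprMn ler_piMr ?sqr_ge0 //; nra.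
  under eq_bigr do rewrite mulrDr mulrBr mulr1 mulrCA.
  rewrite big_split sumrB /= -mulr_suml -mulr_sumr p_sum1.
  have := ler_wpM2l eta_ge0 (g_mean z); lra.
have [w Fw] := exists_le_mean p_ge0 p_sum1 mean_le.
exists [tuple of w :: W]; apply: le_trans Fw.
apply: ler_sum => z _; rewrite /V -RexpD big_ord_recl tnth0.
under eq_bigr do rewrite tnthS.
by rewrite mulrDr opprD addrC.
Qed.

(** A Chernoff bound with union over [Z]: each term is at most the whole potential, so taking
    logarithms bounds every sample sum from below. *)
Lemma exists_sample (m k : nat) :
    (#|Z| <= 2 ^ m)%N -> (576 * m <= k)%N ->
  exists W : k.-tuple Omega,
    forall z, 7 / 12 * k%:R <= \sum_(i < k) g (tnth W i) z.
Proof.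
(* With eta = 1/24 each point lowers the exponent by 15/576, whence S >= 15k/24 - 24m. As 24m <=
   k/24, this is at least 14k/24 = 7k/12. *)
move=> leZ lek; have eta_ge0 : 0 <= 1 / 24 :> R by lra.
have [W potW] := exists_sample_potential k eta_ge0; exists W => z.
set S := \sum_(i < k) _.
have lekR : 576 * m%:R <= k%:R :> R by rewrite -natrM ler_nat.
have Z_le : #|Z|%:R <= exp (m%:R).
  apply: (@le_trans _ _ (2 ^+ m)); first by rewrite -natrX ler_nat.
  rewrite -[m%:R]/(1 *+ m) RexpMn lerXn2r ?nnegrE ?ler0n //.
    exact: ltW (Rexp_gt0 _).
  by have := Rexp_ge1Dx 1.
have : exp (- (1 / 24 * S)) <=
    exp (m%:R + (- (2 / 3 * (1 / 24) - (1 / 24) ^+ 2)) *+ k).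
  rewrite RexpD (RexpMn _ k).
  apply: le_trans (ler_wpM2r (exprn_ge0 _ (ltW (Rexp_gt0 _))) Z_le).
  apply: le_trans potW; rewrite (bigD1 z) //= lerDl.
  by apply: sumr_ge0 => z' _; apply: ltW (Rexp_gt0 _).
move=> /Rexp_le_inv; rewrite -mulr_natr; lra.
Qed.

End Sampling.

(** * Fingerprints of a sampled protocol *)

(* The flag [b] splits off a constant part that shifts the overlap by [1/2], so
   that its square is linear to first order in the acceptance probability; the
   flag [h] marks the coordinates that make [receiver_state] a unit vector. *)
Section Fingerprints.
Variables (X Y : Type) (kappa a : nat).
Variables (msg : 'I_(2 ^ kappa) -> X -> bits a).
Variables (g : 'I_(2 ^ kappa) -> bits a -> Y -> R).
Hypothesis g_unit : forall i m y, 0 <= g i m y <= 1.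

Definition fp_index : finType := ((bool * bool) * ('I_(2 ^ kappa) * bits a))%type.

(** [u] gives each of the sender's two halves squared norm 1/2; [s] spreads an amplitude evenly over
    the [2 ^ a] messages. *)
Let u : R := Num.sqrt (2 * 2 ^+ kappa)^-1.
Let s : R := Num.sqrt (2 ^+ a)^-1.

Definition sender_state (x : X) (z : fp_index) : R :=
  let: ((b, h), (i, m)) := z in
  if h then 0 else if b then (m == msg i x)%:R * u else u * s.

Definition receiver_state (y : Y) (z : fp_index) : R :=
  let: ((b, h), (i, m)) := z in
  if b then (if h then Num.sqrt (1 - g i m y ^+ 2) else g i m y) * (u * s)
  else if h then 0 else u * s.

Lemma card_bits : #|bits a| = (2 ^ a)%N.
Proof. by rewrite card_ffun card_bool card_ord. Qed.

Lemma card_fp_index : #|fp_index| = (2 ^ (kappa + a + 2))%N.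
Proof. by rewrite !card_prod !card_bool card_ord card_bits !expnD mulnC. Qed.

Lemma sum_fp_index (F : fp_index -> R) :
  \sum_z F z = \sum_(i < 2 ^ kappa) \sum_(m : bits a)
    (F ((true, true), (i, m)) + F ((true, false), (i, m)) +
     F ((false, true), (i, m)) + F ((false, false), (i, m))).
Proof.
transitivity (\sum_(p : bool * bool) \sum_(q : 'I_(2 ^ kappa) * bits a) F (p, q)).
  by rewrite pair_bigA; apply: eq_bigr => -[].
rewrite exchange_big [RHS]pair_bigA; apply: eq_bigr => -[i m] _ /=.
transitivity (\sum_(b : bool) \sum_(h : bool) F ((b, h), (i, m))).
  by rewrite pair_bigA; apply: eq_bigr => -[].
by rewrite !big_bool /= !addrA.
Qed.

Let pow2_neq0 k : 2 ^+ k != 0 :> R. Proof. by rewrite expf_neq0 // pnatr_eq0. Qed.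

Let u2E : u ^+ 2 = (2 * 2 ^+ kappa)^-1.
Proof. by rewrite sqr_sqrtr // invr_ge0 mulr_ge0 // exprn_ge0. Qed.

Let s2E : s ^+ 2 = (2 ^+ a)^-1.
Proof. by rewrite sqr_sqrtr // invr_ge0 exprn_ge0. Qed.

Let sum_const2 (c : R) :
  \sum_(i < 2 ^ kappa) \sum_(m : bits a) c = 2 ^+ kappa * 2 ^+ a * c.
Proof.
rewrite !sumr_const card_bits card_ord -mulrnA -[c *+ _]mulr_natl.
by rewrite natrM !natrX [2 ^+ a * _]mulrC.
Qed.

Let sum_msg (F : 'I_(2 ^ kappa) -> bits a -> R) x :
  \sum_(i < 2 ^ kappa) \sum_m (m == msg i x)%:R * F i m =
  \sum_(i < 2 ^ kappa) F i (msg i x).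
Proof.
apply: eq_bigr => i _; under eq_bigr do rewrite mulr_natl mulrb.
by rewrite -big_mkcond big_pred1_eq.
Qed.

Lemma sender_state_unit x : \sum_z sender_state x z ^+ 2 = 1.
Proof.
rewrite sum_fp_index /=.
transitivity (\sum_(i < 2 ^ kappa) \sum_m
  ((m == msg i x)%:R * u ^+ 2 + u ^+ 2 * s ^+ 2)).
  by apply: eq_bigr => i _; apply: eq_bigr => m _; case: eqP => _ /=; ring.
under eq_bigr do rewrite big_split; rewrite big_split /= sum_const2.
rewrite (sum_msg (fun _ _ => u ^+ 2)) sumr_const card_ord -[_ *+ (2 ^ _)]mulr_natl natrX.
by rewrite u2E s2E; field; rewrite !pow2_neq0.
Qed.

Lemma receiver_state_unit y : \sum_z receiver_state y z ^+ 2 = 1.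
Proof.
rewrite sum_fp_index /=.
transitivity (\sum_(i < 2 ^ kappa) \sum_(m : bits a) (2 * (u ^+ 2 * s ^+ 2))).
  apply: eq_bigr => i _; apply: eq_bigr => m _.
  have /andP[g0 g1] := g_unit i m y.
  rewrite ![(_ * (u * s)) ^+ 2]exprMn sqr_sqrtr; first by ring.
  by rewrite subr_ge0 expr_le1.
by rewrite sum_const2 u2E s2E; field; rewrite !pow2_neq0.
Qed.

Lemma overlapE x y : \sum_z sender_state x z * receiver_state y z =
  (1 + s * ((\sum_i g i (msg i x) y) / 2 ^+ kappa)) / 2.
Proof.
rewrite sum_fp_index /=.
transitivity (\sum_(i < 2 ^ kappa) \sum_m
  ((m == msg i x)%:R * (g i m y * (u ^+ 2 * s)) + u ^+ 2 * s ^+ 2)).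
  by apply: eq_bigr => i _; apply: eq_bigr => m _; case: eqP => _ /=; ring.
under [LHS]eq_bigr do rewrite big_split; rewrite big_split /= sum_const2 sum_msg.
by rewrite -mulr_suml u2E s2E; field; rewrite !pow2_neq0.
Qed.

(** Here r = (1 + s P)/2 with P the sampled acceptance rate. Moving P from 1/2 to 7/12 or 5/12
    changes the linear term of r^2 by s/24, and the quadratic term moves in the same direction. *)
Lemma overlap_separated x y (v : bool) :
    (let S := \sum_i g i (msg i x) y in
     if v then 7 / 12 * 2 ^+ kappa <= S else S <= 5 / 12 * 2 ^+ kappa) ->
  let r := \sum_z sender_state x z * receiver_state y z in
  if v then ((1 + s / 2) / 2) ^+ 2 + s / 24 <= r ^+ 2
  else r ^+ 2 <= ((1 + s / 2) / 2) ^+ 2 - s / 24.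
Proof.
have s_ge0 : 0 <= s by apply: sqrtr_ge0.
have k_gt0 : 0 < 2 ^+ kappa :> R by rewrite exprn_gt0.
have S_ge0 : 0 <= \sum_i g i (msg i x) y.
  by apply: sumr_ge0 => i _; case/andP: (g_unit i (msg i x) y).
rewrite /= overlapE; set S := \sum_i _ in S_ge0 *.
rewrite -(ler_pdivlMr _ _ k_gt0) -(ler_pdivrMr _ S k_gt0).
have : 0 <= S / 2 ^+ kappa by rewrite divr_ge0 // ltW.
move: (S / _) => P P_ge0.
have mono (c d : R) : 0 <= c -> c <= d -> (1 + c) ^+ 2 <= (1 + d) ^+ 2.
  by move=> c_ge0 le_cd; rewrite ler_sqr ?nnegrE; lra.
have s2_ge0 := sqr_ge0 s; case: v => leP.
  have c_ge0 : 0 <= s * (7 / 12) by lra.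
  have := mono _ _ c_ge0 (ler_wpM2l s_ge0 leP); lra.
have := mono _ _ (mulr_ge0 s_ge0 P_ge0) (ler_wpM2l s_ge0 leP); lra.
Qed.

(** The number of copies is chosen for this: 1728 = 3 * 24^2 and [s ^+ 2] is the inverse of
    [2 ^ a]. *)
Lemma gap_sqr : 3 <= (1728 * 2 ^ a)%:R * (s / 24) ^+ 2.
Proof.
rewrite exprMn s2E natrM natrX.
by rewrite (_ : _ * _ = 3) //; field; rewrite pow2_neq0.
Qed.

Lemma gap_gt0 : 0 < s / 24.
Proof. by rewrite divr_gt0 // sqrtr_gt0 invr_gt0 exprn_gt0. Qed.

End Fingerprints.

(** * Quantum simulation of a sampled protocol *)

(** Each party sends [1728 * 2 ^ a] copies of a state on [kappa] index qubits, [a] message qubits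
    and two flag qubits. *)
Definition copies_qubits (kappa a : nat) :=
  ((kappa + a + 2) * (1728 * 2 ^ a) + (kappa + a + 2) * (1728 * 2 ^ a))%N.

Section SampledProtocol.
Variables (n kappa a b : nat) (f : bits n -> bits n -> bool).
Variables (A : 'I_(2 ^ kappa) -> bits n -> bits a).
Variables (B : 'I_(2 ^ kappa) -> bits n -> bits b).
Variable ref : bits a -> bits b -> R.
Hypothesis ref_unit : forall ma mb, 0 <= ref ma mb <= 1.
Hypothesis sampled : forall x y,
  let S := \sum_i ref (A i x) (B i y) in
  if f x y then 7 / 12 * 2 ^+ kappa <= S else S <= 5 / 12 * 2 ^+ kappa.

Lemma quantSMP_left : quantSMP f (copies_qubits kappa a).
Proof.
pose g i m y := ref m (B i y).
have g_unit i m y : 0 <= g i m y <= 1 by apply: ref_unit.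
apply: (swap_test_protocol (alpha := sender_state A)
  (beta := receiver_state g) (card_fp_index kappa a)
  (sender_state_unit A) (receiver_state_unit g_unit) (gap_gt0 a) (gap_sqr a)).
move=> x y; exact: (overlap_separated (msg := A) g_unit (sampled x y)).
Qed.

Lemma quantSMP_right : quantSMP f (copies_qubits kappa b).
Proof.
pose g i m x := ref (A i x) m.
have g_unit i m x : 0 <= g i m x <= 1 by apply: ref_unit.
apply: (swap_test_protocol (alpha := receiver_state g)
  (beta := sender_state B) (card_fp_index kappa b)
  (receiver_state_unit g_unit) (sender_state_unit B) (gap_gt0 b) (gap_sqr b)).
move=> x y /=; under eq_bigr do rewrite mulrC.
exact: (overlap_separated (msg := B) g_unit (sampled x y)).
Qed.

End SampledProtocol.

Lemma pubSMP_quantSMP n f c : pubSMP (n := n) f c ->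
  exists a, (2 * a <= c)%N /\
    forall kappa, (1152 * n <= 2 ^ kappa)%N -> quantSMP f (copies_qubits kappa a).
Proof.
case=> a [b [Omega [p [A [B [ref [<- [p_ge0 [p1 [ref_unit correct]]]]]]]]]].
(* [g] is the probability of a correct answer, so its mean is at least 2/3 on all inputs and a
   single lower-tail bound serves both values of [f]. *)
pose g w (z : bits n * bits n) : R :=
  let r := ref (A w z.1) (B w z.2) in if f z.1 z.2 then r else 1 - r.
have g_unit w z : 0 <= g w z <= 1.
  by have := ref_unit (A w z.1) (B w z.2); rewrite /g; case: ifP => _; lra.
have g_mean z : 2 / 3 <= \sum_w p w * g w z.
  have := correct z.1 z.2; rewrite /g; case: ifP => _ //=.
  under [X in _ -> _ <= X]eq_bigr do rewrite mulrBr mulr1.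
  by rewrite sumrB p1; lra.
have sample kappa : (1152 * n <= 2 ^ kappa)%N ->
    exists W : (2 ^ kappa).-tuple Omega, forall x y,
    let S := \sum_i ref (A (tnth W i) x) (B (tnth W i) y) in
    if f x y then 7 / 12 * 2 ^+ kappa <= S else S <= 5 / 12 * 2 ^+ kappa.
  move=> le_kappa.
  have card_Z : (#|{: bits n * bits n}| <= 2 ^ (n + n))%N.
    by rewrite card_prod card_bits expnD.
  (* 1152 = 2 * 576, as there are [2 ^ (n + n)] input pairs to control. *)
  have le_k : (576 * (n + n) <= 2 ^ kappa)%N by lia.
  have [W gW] := exists_sample p_ge0 p1 g_unit g_mean card_Z le_k.
  exists W => x y; have := gW (x, y); rewrite /g natrX /=.
  case: ifP => _ //; rewrite sumrB sumr_const card_ord natrX; lra.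
(* The party with the shorter message plays the sender, which gives [2 * a <= c]. *)
have [ab|ba] := leqP a b.
  exists a; split=> [|kappa /sample[W sampled]]; first by lia.
  exact: quantSMP_left ref_unit sampled.
exists b; split=> [|kappa /sample[W sampled]]; first by lia.
exact: quantSMP_right ref_unit sampled.
Qed.

(** * Logarithms and the final cost bound *)

Lemma trunc_log_le_ln n : (2 <= n)%N ->
  (trunc_log 2 n)%:R <= 2 * Rpower.ln n%:R.
Proof.
move=> n2; have n_gt0 : 0 < n%:R :> R by rewrite ltr0n; lia.
suff : (trunc_log 2 n)%:R * Rpower.ln 2 <= Rpower.ln n%:R.
  have ln2 : 1 / 2 <= Rpower.ln 2 :> R.
    have /RltP := Rpower.ln_lt_2.
    by rewrite IZRposE INRE RinvE div1r => /ltW.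
  have := ler_wpM2l (ler0n R (trunc_log 2 n)) ln2; lra.
have le2n : 2 ^+ trunc_log 2 n <= n%:R :> R.
  by rewrite -natrX ler_nat trunc_logP //; lia.
have pow_gt0 : 0 < 2 ^+ trunc_log 2 n :> R by rewrite exprn_gt0.
have -> : (trunc_log 2 n)%:R * Rpower.ln 2 = Rpower.ln (2 ^+ trunc_log 2 n).
  by rewrite -RpowE Rpower.ln_pow ?INRE //; apply/RltP.
move: le2n; rewrite le_eqVlt => /predU1P[->//|lt2n].
by apply/ltW/RltP/Rpower.ln_increasing; apply/RltP.
Qed.

Theorem mainTheorem3 :
  exists C : Rdefinitions.R, 0 < C /\
    forall (n : nat), (2 <= n)%N ->
    forall (f : bits n -> bits n -> bool) (c : nat),
      pubSMP f c ->
      exists q : nat, quantSMP f q /\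
        (q%:R <= C * 2%:R ^+ c * Rpower.ln (n%:R)).
Proof.
(* 3456 = 2 * 1728 counts the copies of both parties, 16 comes from the qubits per copy, and 2 from
   passing to the natural logarithm. *)
exists (3456 * 16 * 2); split; first by lra.
move=> n n2 f c /pubSMP_quantSMP[a [le_ac quant]].
set l := trunc_log 2 n.
have l_ge1 : (1 <= l)%N by apply: trunc_log_max.
have lt_n : (n < 2 ^ l.+1)%N by apply: trunc_log_ltn.
(* [n < 2 ^ l.+1] and 1152 <= 2^11 leave room for the sample. *)
exists (copies_qubits (l.+1 + 11) a); split.
  by apply: quant; rewrite expnD; lia.
have lt_a : (a < 2 ^ a)%N by apply: ltn_expl.
have pow_le : (2 ^ a * 2 ^ a <= 2 ^ c)%N.
  by rewrite -expnD leq_exp2l // addnn -mul2n.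
have cost_le : (copies_qubits (l.+1 + 11) a <= 3456 * 16 * 2 ^ c * l)%N.
  rewrite /copies_qubits.
  move: (2 ^ a)%N (2 ^ c)%N lt_a pow_le => P Q lt_a pow_le.
  (* The [a] message qubits per copy are absorbed in a second factor [2 ^ a]; times the [2 ^ a]
     copies this stays below [2 ^ c]. *)
  have h1 : (l.+1 + 11 + a + 2 <= 16 * (P * l))%N by nia.
  have h2 : (P * (16 * (P * l)) <= 16 * (Q * l))%N by nia.
  have h3 := leq_mul (leqnn P) h1; lia.
apply: (@le_trans _ _ (3456 * 16 * 2 ^ c * l)%:R); first by rewrite ler_nat.
have := trunc_log_le_ln n2; rewrite -/l => le_l.
have c_ge0 : 0 <= 3456 * 16 * 2 ^+ c :> R by rewrite !mulr_ge0 ?exprn_ge0.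
have := ler_wpM2l c_ge0 le_l; rewrite !natrM natrX; lra.
Qed.
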